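(* Let $n\ge1$. The map $\mathrm{LK}^{P}$ is a bijection from $\mathcal{D}^P_n$ onto $\mathcal{D}^H_n$, with inverse $\mathrm{LK}^{H}$. Moreover, $\mathrm{LK}^{P}$ restricts to an involution on $\mathcal{D}^P_n\cap\mathcal{D}^H_n$.
   Context: Lattice paths use horizontal steps $(x,y)\to(x,y+1)$ and vertical steps $(x,y)\to(x+1,y)$. An $n$-periodic Dyck path is a bi-infinite lattice path invariant under translation by $(n,n)$ whose vertical step from $x=k$ to $x=k+1$ (there is exactly one for each $k\in\mathbb{Z}$) has $y$-coordinate $h_k\ge k+1$. Its area sequence is the $n$-periodic sequence $c_k=h_k-k+1$ ($k\in\mathbb{Z}$); these are exactly the $n$-periodic integer sequences with $c_k\ge2$ and $c_{k+1}+1\ge c_k$, and each determines the path. A valley at $(x,y)$ is a vertical step ending at $(x,y)$ immediately followed by a horizontal step. A rectangle at $(i+1,j)$ is a valley at $(i+1,j)$ such that the next valley has $x$-coordinate strictly larger than $j+1$ (in terms of the area sequence: $c_{i+1}+1=c_i+c_{i+c_i}$ with $j=i+c_i-1$). A return at position $p$ is a vertical step ending at $(p,p)$. A double rise with midpoint $(x,y)$: consecutive horizontal steps $(x,y-1)\to(x,y)\to(x,y+1)$; a double fall with midpoint $(x,y)$: consecutive vertical steps $(x-1,y)\to(x,y)\to(x+1,y)$. $\mathcal{D}^P_n$ is the set of $n$-periodic Dyck paths whose area sequence is non-constant with minimal entry $2$; $\mathcal{D}^H_n$ is the set of $n$-periodic Dyck paths having a rectangle. For $D\in\mathcal{D}^P_n$,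 choose a return position $p$ of $D$; let $(r_t)_{t\in\mathbb{Z}}$ be the increasing enumeration of the $y$-coordinates of the midpoints of the double rises of $D$, indexed so that $r_1$ is the smallest one exceeding $p$, and $(f_t)_{t\in\mathbb{Z}}$ the increasing enumeration of the $x$-coordinates of the midpoints of the double falls, with $f_1$ the smallest exceeding $p$. Then $\mathrm{LK}^P(D)$ is the $(n,n)$-periodic lattice path whose valleys are exactly $\{(r_t,f_t):t\in\mathbb{Z}\}$ (this does not depend on the choice of $p$). For $D\in\mathcal{D}^H_n$, choose $j$ such that $D$ has a rectangle with $y$-coordinate $j$; then $D$ has a double rise with midpoint $y$-coordinate $j+1$ and a double fall with midpoint $x$-coordinate $j+1$. Enumerate these midpoint coordinates increasingly as $(r_t)_{t\in\mathbb{Z}}$, $(f_t)_{t\in\mathbb{Z}}$ with $r_1=f_1=j+1$; then $\mathrm{LK}^H(D)$ is the $(n,n)$-periodic lattice path whose valleys are exactly $\{(r_t,f_t):t\in\mathbb{Z}\}$ (this does not depend on the choice of $j$). *)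

(* Defs.v *)
From HB Require Import structures.
From mathcomp Require Export all_boot all_order all_algebra.
From mathcomp Require Export boolp classical_sets functions.

Set Implicit Arguments.
Unset Strict Implicit.
Unset Printing Implicit Defensive.

Import Order.TTheory GRing.Theory Num.Theory.
Local Open Scope ring_scope.
Local Open Scope classical_set_scope.

(* A bi-infinite lattice path invariant under translation by (n, n), n >= 1,
   has exactly one vertical step (k, y) -> (k + 1, y) for each k, and is
   determined by the heights h k := y of these steps, which form a
   nondecreasing sequence.  Paths are represented by h. *)
Definition lattice_path := int -> int.

Definition periodic_path (n : nat) (h : lattice_path) : Prop :=
  {homo h : k l / k <= l} /\ forall k, h (k + n%:Z) = h k + n%:Z.

(* h has the vertical step (x, y) -> (x + 1, y). *)
Definition vstep (h : lattice_path) (x y : int) : Prop := h x = y.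

(* h has the horizontal step (x, y) -> (x, y + 1): the path enters the line of
   first coordinate x at (x, h (x - 1)) and leaves it at (x, h x). *)
Definition hstep (h : lattice_path) (x y : int) : Prop :=
  h (x - 1) <= y /\ y + 1 <= h x.

Definition periodic_dyck (n : nat) (h : lattice_path) : Prop :=
  periodic_path n h /\ forall k, k + 1 <= h k.

Definition area (h : lattice_path) (k : int) : int := h k - k + 1.

Definition valley (h : lattice_path) : set (int * int) :=
  [set v | vstep h (v.1 - 1) v.2 /\ hstep h v.1 v.2].

Definition double_rise (h : lattice_path) : set (int * int) :=
  [set m | hstep h m.1 (m.2 - 1) /\ hstep h m.1 m.2].

Definition double_fall (h : lattice_path) : set (int * int) :=
  [set m | vstep h (m.1 - 1) m.2 /\ vstep h m.1 m.2].

Definition rises (h : lattice_path) : set int :=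
  [set y | exists x, double_rise h (x, y)].

Definition falls (h : lattice_path) : set int :=
  [set x | exists y, double_fall h (x, y)].

(* Distinct valleys have distinct first coordinates, and they occur along the
   path in the order of these. *)
Definition next_valley (h : lattice_path) (v w : int * int) : Prop :=
  [/\ valley h w, v.1 < w.1 &
      forall u, valley h u -> v.1 < u.1 -> w.1 <= u.1].

Definition rectangle (h : lattice_path) : set (int * int) :=
  [set v | valley h v /\ exists w, next_valley h v w /\ v.2 + 1 < w.1].

Definition return_at (h : lattice_path) (p : int) : Prop := vstep h (p - 1) p.

Definition constant_seq (c : int -> int) : Prop := exists m, forall k, c k = m.

Definition minimal_entry (c : int -> int) (m : int) : Prop :=
  (exists k, c k = m) /\ forall k, m <= c k.

Definition DP (n : nat) : set lattice_path :=
  [set h | [/\ periodic_dyck n h, ~ constant_seq (area h)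
             & minimal_entry (area h) 2]].

Definition DH (n : nat) : set lattice_path :=
  [set h | periodic_dyck n h /\ exists v, rectangle h v].

Definition increasing_enum (A : set int) (a : int -> int) : Prop :=
  {homo a : s t / s < t} /\ range a = A.

Definition smallest_above (A : set int) (p m : int) : Prop :=
  [/\ A m, p < m & forall x, A x -> p < x -> m <= x].

Definition path_with_valleys (n : nat) (r f : int -> int) (E : lattice_path) :
  Prop := periodic_path n E /\ valley E = range (fun t => (r t, f t)).

Definition is_LKP (n : nat) (D E : lattice_path) : Prop :=
  exists p r f,
  [/\ return_at D p,
      increasing_enum (rises D) r /\ smallest_above (rises D) p (r 1),
      increasing_enum (falls D) f /\ smallest_above (falls D) p (f 1)
    & path_with_valleys n r f E].

Definition is_LKH (n : nat) (D E : lattice_path) : Prop :=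
  exists j r f,
  [/\ exists x, rectangle D (x, j),
      increasing_enum (rises D) r /\ r 1 = j + 1,
      increasing_enum (falls D) f /\ f 1 = j + 1
    & path_with_valleys n r f E].

(* The default value [fun=> 0], taken when no E is as required, is not an
   n-periodic path for n >= 1, so it belongs to neither DP n nor DH n. *)
Definition LKP (n : nat) (D : lattice_path) : lattice_path :=
  xget (fun=> 0 : int) (is_LKP n D).

Definition LKH (n : nat) (D : lattice_path) : lattice_path :=
  xget (fun=> 0 : int) (is_LKH n D).

(* Main.v *)
(* Let Y be the set of heights of a path h and F the set of its falls; the
   valleys then have second coordinates Y and first coordinates ~F, and the
   rises of h are ~Y.  Hence LKP and LKH both complement and exchange the two
   coordinate sets of the valleys, and only the matching of the two sets has to
   be controlled.  It is recorded by gap h k, which for a Dyck path counts the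
   elements of Y strictly between k and h k; it satisfies
     gap h k - gap h (k - 1) = [k \notin F] - [k \in Y],
   and h is determined by Y and gap h.  A path is Dyck iff its gap is
   nonnegative, and then it has a return at p iff p \notin F, p \in Y and
   gap h p = 0, and a rectangle iff gap h q = 0 for some q \in F, q \notin Y;
   this q is a rectangle's y-coordinate plus 1 if q - 1 \in Y.  Both maps keep
   the gap function, so each is the symmetric relation "same gap, complemented
   and exchanged coordinates", which swaps the conditions for returns and
   rectangles. *)
Require Import Defs.
From mathcomp Require Import all_boot all_order all_algebra.
From mathcomp Require Import boolp classical_sets functions.
From mathcomp Require Import zify.
Import Order.TTheory GRing.Theory Num.Theory.
Local Open Scope ring_scope.
Local Open Scope classical_set_scope.

Set Implicit Arguments.
Unset Strict Implicit.

(** * Induction on the integers and first passage of monotone sequences *)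

Lemma int_bidirectional_ind (P : int -> Prop) (k0 : int) :
  P k0 -> (forall k : int, P k <-> P (k - 1)) -> forall k, P k.
Proof.
move=> P0 PS k.
have up (m : nat) : P (k0 + m%:Z).
  elim: m => [|m IH]; first by rewrite addr0.
  by apply/PS; have -> : k0 + m.+1%:Z - 1 = k0 + m%:Z by lia.
have dn (m : nat) : P (k0 - m%:Z).
  elim: m => [|m IH]; first by rewrite subr0.
  by rewrite (_ : k0 - m.+1%:Z = k0 - m%:Z - 1); [apply: (PS _).1 | lia].
have [le|lt] := leP k0 k.
  by rewrite (_ : k = k0 + `|k - k0|%N%:Z) //; lia.
by rewrite (_ : k = k0 - `|k0 - k|%N%:Z) //; lia.
Qed.

Lemma nondecreasing_of_step (g : int -> int) :
  (forall k : int, g (k - 1) <= g k) -> {homo g : k l / k <= l}.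
Proof.
move=> gS k l kl.
have -> : l = k + `|l - k|%N%:Z by lia.
elim: `|l - k|%N => [|m IH]; first by rewrite addr0.
have := gS (k + m.+1%:Z); have -> : k + m.+1%:Z - 1 = k + m%:Z by lia.
exact: le_trans.
Qed.

Lemma int_least (P : int -> Prop) (lo hi : int) :
  P hi -> (forall k, P k -> lo <= k) ->
  exists m, P m /\ forall k, P k -> m <= k.
Proof.
move=> Phi Plo.
have ex : exists m : nat, `[<P (lo + m%:Z)>].
  exists `|hi - lo|%N; apply/asboolP.
  by rewrite (_ : lo + _ = hi) //; have := Plo _ Phi; lia.
case: (ex_minnP ex) => m /asboolP Pm mmin.
exists (lo + m%:Z); split=> // k Pk.
have lok := Plo _ Pk.
have := mmin `|k - lo|%N.
have -> : lo + `|k - lo|%N%:Z = k by lia.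
by move=> /(_ (asboolT Pk)); lia.
Qed.

Section Quasiperiodic.
Variables (n : nat) (d : int) (g : int -> int).
Hypotheses (n_gt0 : (1 <= n)%N) (d_gt0 : 1 <= d).
Hypothesis g_mono : forall k : int, g (k - 1) <= g k.
Hypothesis g_per : forall k : int, g (k + n%:Z) = g k + d.

Lemma quasiperiodic_unbounded (t : int) :
  exists lo hi : int, g lo < t /\ t <= g hi.
Proof.
have gm (m : int) : g (m * n%:Z) = g 0 + m * d.
  move: m; apply: (int_bidirectional_ind (k0 := 0)) => [|m].
    by rewrite !mul0r addr0.
  have -> : m * n%:Z = (m - 1) * n%:Z + n%:Z by lia.
  rewrite g_per; split; lia.
(* Each period adds [d >= 1]; the extra period downwards makes the first inequality strict. *)
exists ((- `|t - g 0| - 1) * n%:Z), (`|t - g 0| * n%:Z).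
by rewrite !gm; nia.
Qed.

Lemma least_reaching (t : int) : exists k : int, g (k - 1) < t /\ t <= g k.
Proof.
have gle := nondecreasing_of_step g_mono.
have [lo [hi [glo ghi]]] := quasiperiodic_unbounded t.
have [|k [tk kmin]] := @int_least (fun k => t <= g k) lo hi ghi.
  by move=> k tk; rewrite leNgt; apply/negP => /ltW /gle; lia.
exists k; split=> //.
by rewrite ltNge; apply/negP => /kmin; lia.
Qed.

End Quasiperiodic.

(** * Counting functions and enumerations of sets of integers *)

(* The number of elements of A in ]0, k], or minus that in ]k, 0] if k < 0. *)
Definition countz (A : set int) (k : int) : int :=
  match k with
  | Posz m => \sum_(i < m) ((i.+1%:Z \in A) : nat)%:Z
  | Negz m => - \sum_(i < m.+1) ((- i%:Z \in A) : nat)%:Z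
  end.

Section Counting.
Variable A : set int.

Lemma countz_pred (k : int) :
  countz A k = countz A (k - 1) + ((k \in A) : nat)%:Z.
Proof.
case: k => [[|m]|m].
- by rewrite /= big_ord0 big_ord_recr big_ord0 /= add0r oppr0 addNr.
- have -> : m.+1%:Z - 1 = m%:Z by lia.
  by rewrite /= big_ord_recr.
- have -> : Negz m - 1 = Negz m.+1 by lia.
  rewrite /countz [in RHS]big_ord_recr /= NegzE.
  by rewrite opprD addrAC -addrA subrr addr0.
Qed.

Lemma countz_in (k : int) : A k -> countz A k = countz A (k - 1) + 1.
Proof. by move=> Ak; rewrite countz_pred mem_set. Qed.

Lemma countz_notin (k : int) : ~ A k -> countz A k = countz A (k - 1).
Proof. by move=> Ak; rewrite countz_pred memNset // addr0. Qed.

Lemma countz_le : {homo countz A : k l / k <= l}.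
Proof. by apply: nondecreasing_of_step => k; rewrite (countz_pred k); lia. Qed.

Lemma countz_lt (k l : int) : A l -> k < l -> countz A k < countz A l.
Proof.
move=> Al kl; rewrite (countz_in Al).
have : countz A k <= countz A (l - 1) by apply: countz_le; lia.
lia.
Qed.

(** A member of [A] is determined by its rank; equalities between heights are reduced to counts this
    way. *)
Lemma countz_inj (k l : int) : A k -> A l -> countz A k = countz A l -> k = l.
Proof.
move=> Ak Al e.
by have [/(countz_lt Al)|/(countz_lt Ak)|//] := ltgtP k l; lia.
Qed.

Lemma countz_empty (k l : int) :
  k <= l -> (forall m, k < m -> m <= l -> ~ A m) -> countz A l = countz A k.
Proof.
move=> kl; have -> : l = k + `|l - k|%N%:Z by lia.
elim: `|l - k|%N => [|m IH] none; first by rewrite addr0.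
rewrite countz_notin; last by apply: none; lia.
have -> : k + m.+1%:Z - 1 = k + m%:Z by lia.
by apply: IH => i ki im; apply: none; lia.
Qed.

Lemma countz_next (k l : int) :
  A l -> k < l -> (forall m, A m -> k < m -> l <= m) ->
  countz A l = countz A k + 1.
Proof.
move=> Al kl lmin; rewrite countz_in //; congr (_ + 1).
apply: countz_empty; first lia.
by move=> m km ml Am; have := lmin m Am km; lia.
Qed.

Section Periodic.
Variable n : nat.
Hypothesis A_per : forall k : int, A (k + n%:Z) <-> A k.

Lemma countz_period (k : int) :
  countz A (k + n%:Z) = countz A k + countz A n%:Z.
Proof.
move: k; apply: (int_bidirectional_ind (k0 := 0)) => [|k].
  by rewrite add0r [countz A 0]big_ord0 add0r.
rewrite (countz_pred (k + _)) (countz_pred k).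
have -> : (k + n%:Z \in A) = (k \in A) by apply/asbool_equiv_eq; exact: A_per.
have -> : k + n%:Z - 1 = k - 1 + n%:Z by lia.
split; lia.
Qed.

Hypothesis n_gt0 : (1 <= n)%N.
Hypothesis A_nonempty : exists x, A x.

Lemma countz_period_gt0 : 1 <= countz A n%:Z.
Proof.
have [x Ax] := A_nonempty.
have := @countz_lt x (x + n%:Z) ((A_per _).2 Ax).
by rewrite countz_period; lia.
Qed.

(** The count climbs by at most one at a time, so where it first reaches [t] it equals [t] and has
    just met a member of [A]. *)
Lemma countz_onto (t : int) : exists k, A k /\ countz A k = t.
Proof.
have [k|k|k [k1 k2]] :=
    @least_reaching n _ (countz A) n_gt0 countz_period_gt0 _ _ t.
- by rewrite (countz_pred k); lia.
- exact: countz_period.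
have [Ak|nAk] := pselect (A k).
  by exists k; split => //; have := countz_in Ak; lia.
by have := countz_notin nAk; lia.
Qed.

(** The enumeration inverts the rank; the shift by [countz A p] gives index 1 to the first member
    beyond [p]. *)
Lemma increasing_enum_exists (p : int) :
  exists a, increasing_enum A a /\ forall t, countz A (a t) = t + countz A p.
Proof.
have /choice[a aP] : forall t, exists k, A k /\ countz A k = t + countz A p.
  by move=> t; exact: countz_onto.
exists a; split; last by move=> t; exact: (aP t).2.
split.
  move=> s t st; rewrite ltNge; apply/negP => /countz_le.
  by rewrite !(aP _).2; lia.
apply/seteqP; split => [_ [t _ <-]|x Ax]; first exact: (aP t).1.
exists (countz A x - countz A p) => //.
apply: countz_inj => //; first exact: (aP _).1.
by rewrite (aP _).2; lia.
Qed.

End Periodic.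
End Counting.

(** * Falls, rises and valleys in terms of heights *)

Lemma fallsE (h : lattice_path) (x : int) : falls h x <-> h (x - 1) = h x.
Proof.
split=> [[y [/= h1 h2]]|e]; first by rewrite h1 h2.
by exists (h x).
Qed.

Section Paths.
Variables (n : nat) (h : lattice_path).
Hypothesis h_path : periodic_path n h.

Lemma not_fallsE (x : int) : ~ falls h x <-> h (x - 1) < h x.
Proof.
have /h_path.1 : x - 1 <= x by lia.
by rewrite fallsE; split; lia.
Qed.

Lemma valleyE (x y : int) : valley h (x, y) <-> h (x - 1) = y /\ ~ falls h x.
Proof.
rewrite not_fallsE; split=> [[/= e [_ lt]]|[e lt]].
  by split; [exact: e | rewrite (e : h (x - 1) = y); lia].
by split; [exact: e | split=> /=; lia].
Qed.

Lemma falls_periodic (k : int) : falls h (k + n%:Z) <-> falls h k.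
Proof.
rewrite !fallsE; have -> : k + n%:Z - 1 = k - 1 + n%:Z by lia.
by rewrite !h_path.2; split; lia.
Qed.

Lemma range_periodic (k : int) : range h (k + n%:Z) <-> range h k.
Proof.
split=> -[x _ hx].
  exists (x - n%:Z) => //; have := h_path.2 (x - n%:Z).
  by rewrite subrK; lia.
by exists (x + n%:Z) => //; rewrite h_path.2; lia.
Qed.

(** At a fall the height is unchanged; otherwise it passes to the next member of the range. *)
Lemma countz_range_step (k : int) :
  countz (range h) (h k) + ((k \in falls h) : nat)%:Z =
  countz (range h) (h (k - 1)) + 1.
Proof.
have [fk|nfk] := pselect (falls h k).
  by rewrite mem_set //; move/fallsE: fk => ->.
rewrite memNset // addr0; move/not_fallsE: nfk => lt.
apply: countz_next => //.
move=> _ [i _ <-] lti; apply: h_path.1.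
rewrite leNgt; apply/negP => ik; have /h_path.1 : i <= k - 1 by lia.
lia.
Qed.

Hypothesis n_gt0 : (1 <= n)%N.

Lemma path_reaching (y : int) : exists x : int, h (x - 1) < y /\ y <= h x.
Proof.
apply: (@least_reaching n n%:Z) => //.
- by move=> k; apply: h_path.1; lia.
- exact: h_path.2.
Qed.

Lemma range_last (y : int) :
  range h y -> exists x : int, h (x - 1) = y /\ ~ falls h x.
Proof.
move=> [k _ hk].
(* The first index above height [y] comes just after the last vertical step at [y]. *)
have [x [x1 x2]] := path_reaching (y + 1).
exists x; rewrite not_fallsE.
suff : y <= h (x - 1) by lia.
rewrite -hk; apply: h_path.1; rewrite leNgt; apply/negP => xk.
have : h x <= h k by apply: h_path.1; lia.
lia.
Qed.

(** A height without a vertical step is crossed in the interior of a horizontal run. *)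
Lemma risesE : rises h = ~` range h.
Proof.
apply/seteqP; split => y.
  move=> [x [/= [h1 h2] [h3 h4]]] [k _ hk].
  have [/h_path.1|] := leP k (x - 1); first lia.
  move=> xk; have : h x <= h k by apply: h_path.1; lia.
  lia.
move=> ny.
have [x [x1 x2]] := path_reaching y.
have ? : h x <> y by move=> e; apply: ny; exists x.
by exists x; split; split => /=; lia.
Qed.

Lemma rises_periodic (k : int) : rises h (k + n%:Z) <-> rises h k.
Proof. by rewrite risesE /=; split; apply: contra_not => /range_periodic. Qed.

End Paths.

(** * The gap function *)

(* When h is a Dyck path, the number of valleys (x, y) with x <= k < y. *)
Definition gap (h : lattice_path) (k : int) : int :=
  countz (range h) (h k) - countz (range h) k - 1.

(** Since [h k] is itself counted, [k < h k] holds exactly when the rank of [h k] exceeds that of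
    [k]. *)
Lemma dyck_gapP (h : lattice_path) :
  (forall k : int, k + 1 <= h k) <-> (forall k, 0 <= gap h k).
Proof.
split=> H k.
  have : countz (range h) k < countz (range h) (h k).
    by apply: countz_lt; [exists k | have := H k; lia].
  rewrite /gap; lia.
rewrite leNgt; apply/negP => lt.
have /(@countz_le (range h)) : h k <= k by lia.
by have := H k; rewrite /gap; lia.
Qed.

Section Gap.
Variables (n : nat) (h : lattice_path).
Hypothesis h_path : periodic_path n h.

Lemma gap_pred (k : int) :
  gap h k + ((k \in range h) : nat)%:Z + ((k \in falls h) : nat)%:Z =
  gap h (k - 1) + 1.
Proof.
rewrite /gap (countz_pred _ k).
have := countz_range_step h_path k; lia.
Qed.

Lemma gap_period (k : int) : gap h (k + n%:Z) = gap h k.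
Proof.
rewrite /gap h_path.2 !(@countz_period _ n) //; first lia.
all: exact: range_periodic.
Qed.

End Gap.

(** * Duality of paths: uniqueness, symmetry, existence *)

Definition dual_path (D E : lattice_path) : Prop :=
  range E = falls D /\ gap E = gap D.

(** The gap fixes the rank of each height within [falls D], hence the height. *)
Lemma dual_unique (D E E' : lattice_path) :
  dual_path D E -> dual_path D E' -> E = E'.
Proof.
move=> [r1 g1] [r2 g2]; apply/funext => k.
apply: (@countz_inj (falls D)); first by rewrite -r1; exists k.
  by rewrite -r2; exists k.
move: (congr1 (@^~ k) g1) (congr1 (@^~ k) g2); rewrite /gap r1 r2; lia.
Qed.

Section Dual.
Variables (n : nat) (D E : lattice_path).
Hypotheses (D_path : periodic_path n D) (E_path : periodic_path n E).

(** By [gap_pred], equal gaps force equal sums of the indicators of range and falls; cancelling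
    [range E = falls D] leaves the claim. *)
Lemma dual_falls : dual_path D E -> falls E = range D.
Proof.
move=> [eR eG]; apply/seteqP.
have key k : (k \in falls E) = (k \in range D).
  have := gap_pred D_path k; have := gap_pred E_path k.
  rewrite eG eR; case: (k \in falls E); case: (k \in range D) => //; lia.
by split=> k /mem_set; [rewrite key | rewrite -key] => /set_mem.
Qed.

Lemma dual_sym : dual_path D E -> dual_path E D.
Proof. by move=> DE; split; [rewrite dual_falls | rewrite DE.2]. Qed.

(* Both gap functions have the same increments, so one point is enough. *)
Lemma dual_of_base (p : int) :
  range E = falls D -> falls E = range D -> gap E p = gap D p -> dual_path D E.
Proof.
move=> eR eF eG; split=> //; apply/funext.
apply: (int_bidirectional_ind (k0 := p)) => // k.
have := gap_pred D_path k; have := gap_pred E_path k.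
rewrite eR eF; split; lia.
Qed.

End Dual.

Lemma dual_exists n D : (1 <= n)%N -> periodic_path n D ->
  (exists x, falls D x) -> exists E, periodic_path n E /\ dual_path D E.
Proof.
move=> n_gt0 D_path F0.
have Fper := falls_periodic D_path.
have /choice[a aP] := countz_onto Fper n_gt0 F0.
(* The rank within [falls D] that the height at [k] must have for the gap to be that of [D]. *)
pose g k := countz (falls D) k + 1 + gap D k.
have g_step (k : int) : g k + ((k \in range D) : nat)%:Z = g (k - 1) + 1.
  by rewrite /g (countz_pred _ k); have := gap_pred D_path k; lia.
have g_per (k : int) : g (k + n%:Z) = g k + countz (falls D) n%:Z.
  by rewrite /g (@countz_period _ n) // (@gap_period n) //; lia.
have g_mono (k : int) : g (k - 1) <= g k by have := g_step k; lia.
have Ec k : countz (falls D) (a (g k)) = g k by exact: (aP _).2.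
have EF k : falls D (a (g k)) by exact: (aP _).1.
have eR : range (a \o g) = falls D.
  apply/seteqP; split=> [_ [k _ <-]|x Fx]; first exact: EF.
  have [k [k1 k2]] := @least_reaching n _ g n_gt0
    (countz_period_gt0 Fper n_gt0 F0) g_mono g_per (countz (falls D) x).
  exists k => //; apply: (@countz_inj (falls D)) => //=; rewrite Ec.
  by have := g_step k; lia.
exists (a \o g); split; last first.
  by split=> //; apply/funext => k; rewrite {1}/gap eR /= Ec /g; lia.
split=> [k l kl|k] /=.
  rewrite leNgt; apply/negP => /(countz_lt (EF k)).
  have := nondecreasing_of_step g_mono kl.
  by rewrite !Ec; lia.
apply: (@countz_inj (falls D)) => //; first exact/Fper.
by rewrite (@countz_period _ n) // !Ec g_per.
Qed.

(** * Returns and rectangles as zeros of the gap *)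

Lemma constant_on_falls h (k l : int) :
  k <= l -> (forall m, k < m -> m <= l -> falls h m) -> h l = h k.
Proof.
move=> kl; have -> : l = k + `|l - k|%N%:Z by lia.
elim: `|l - k|%N => [|m IH] F; first by rewrite addr0.
have /fallsE <- : falls h (k + m.+1%:Z) by apply: F; lia.
have -> : k + m.+1%:Z - 1 = k + m%:Z by lia.
by apply: IH => i ki im; apply: F; lia.
Qed.

Section Families.
Variables (n : nat) (h : lattice_path).
Hypothesis h_path : periodic_path n h.

(** For a height [p] that is not a fall, [gap_pred] moves the zero from [p] to [p - 1], where it
    says that [h (p - 1)] and [p] have equal rank. *)
Lemma return_at_gap (p : int) : (forall k, 0 <= gap h k) ->
  return_at h p <-> [/\ ~ falls h p, range h p & gap h p = 0].
Proof.
move=> g_ge0; have step := gap_pred h_path p.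
have dyck := (dyck_gapP h).2 g_ge0.
split=> [ret|[nFp Yp gp]].
  have hp : h (p - 1) = p := ret.
  have nFp : ~ falls h p.
    by apply/(not_fallsE h_path); rewrite hp; have := dyck p; lia.
  have Yp : range h p by exists (p - 1).
  split=> //; rewrite mem_set // memNset // in step.
  by move: step; rewrite [gap h (p - 1)]/gap hp (@countz_in _ p) //; lia.
rewrite mem_set // memNset // in step.
apply: (@countz_inj (range h)) => //.
by move: step; rewrite [gap h (p - 1)]/gap (@countz_in _ p) // gp; lia.
Qed.

(** Up to the next valley the path stays at height [h x], so [j + 1] is a fall. It lies strictly
    between the consecutive heights [j] and [h x], whence the gap 0. *)
Lemma rectangle_gap (x j : int) : (forall k, 0 <= gap h k) ->
  rectangle h (x, j) ->
  [/\ falls h (j + 1), ~ range h (j + 1) & gap h (j + 1) = 0].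
Proof.
move=> g_ge0 [/(valleyE h_path)[hx nFx]
  [[w1 w2] [[/(valleyE h_path)[_ nFw] /= xw wmin] /= jw]]].
have dyck := (dyck_gapP h).2 g_ge0.
have xj : x <= j by have := dyck (x - 1); rewrite hx; lia.
have Fm (m : int) : x < m -> m < w1 -> falls h m.
  move=> xm mw; apply: contrapT => nFm.
  have /wmin : valley h (m, h (m - 1)) by apply/(valleyE h_path).
  by move=> /(_ xm) /=; lia.
have hxE (l : int) : x <= l -> l < w1 -> h l = h x.
  by move=> xl lw; apply: constant_on_falls => // m xm ml; apply: Fm; lia.
have hw : w1 <= h x.
  by have := dyck (w1 - 1); rewrite hxE; lia.
have nY : ~ range h (j + 1).
  move=> [k _ hk]; have [kx|xk] := leP k (x - 1).
    by have := h_path.1 k (x - 1) kx; lia.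
  have : h x <= h k by apply: h_path.1; lia.
  by lia.
split=> //; first by apply: Fm; lia.
rewrite /gap hxE; [|lia|lia].
rewrite (countz_notin nY) addrK.
have := countz_range_step h_path x.
by rewrite memNset // hx; lia.
Qed.

Hypothesis n_gt0 : (1 <= n)%N.

(** Without falls the area sequence is nondecreasing and periodic, hence constant; a fall makes it
    drop by one. *)
Lemma falls_nonemptyP :
  ~ constant_seq (area h) <-> exists x, falls h x.
Proof.
split=> [nc|[x /fallsE Fx] [m am]]; last first.
  by have := am x; have := am (x - 1); rewrite /area Fx; lia.
apply: contrapT => nF; apply: nc; exists (area h 0).
have step (k : int) : area h (k - 1) <= area h k.
  have : h (k - 1) < h k.
    by apply/(not_fallsE h_path) => Fk; apply: nF; exists k.
  by rewrite /area; lia.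
have mono := nondecreasing_of_step step.
have per (k : int) : area h (k + n%:Z) = area h k.
  by rewrite /area h_path.2; lia.
apply: (int_bidirectional_ind (k0 := 0)) => // k.
have s1 := step k.
have s2 : area h k <= area h (k - 1 + n%:Z) by apply: mono; lia.
rewrite per in s2; split; lia.
Qed.

Lemma rectangle_exists : (forall k, 0 <= gap h k) ->
  (exists q, [/\ falls h q, ~ range h q & gap h q = 0]) ->
  exists v, rectangle h v.
Proof.
move=> g_ge0 [q0 [Fq0 nYq0 gq0]].
have dyck := (dyck_gapP h).2 g_ge0.
have step := gap_pred h_path.
have [j [Yj Fj1 nYj1 gj1]] : exists j : int,
    [/\ range h j, falls h (j + 1), ~ range h (j + 1) & gap h (j + 1) = 0].
  apply: contrapT => none.
  (* Otherwise the pattern at [q0] propagates downwards forever: if [q - 1] were neither a height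
     nor a fall, the gap at [q - 2] would be -1. *)
  have down (m : nat) :
      [/\ falls h (q0 - m%:Z), ~ range h (q0 - m%:Z) & gap h (q0 - m%:Z) = 0].
    elim: m => [|m [Fm nYm gm]]; first by rewrite subr0.
    have -> : q0 - m.+1%:Z = q0 - m%:Z - 1 by lia.
    set q := q0 - m%:Z in Fm nYm gm *.
    have g1 : gap h (q - 1) = 0.
      by have := step q; rewrite memNset // mem_set // gm; lia.
    have nY1 : ~ range h (q - 1).
      by move=> Y1; apply: none; exists (q - 1); rewrite subrK.
    split=> //; apply: contrapT => nF1.
    have := step (q - 1); have := g_ge0 (q - 1 - 1).
    by rewrite memNset // memNset // g1; lia.
  (* But some height lies below [q0]. *)
  have [x [hx _]] := path_reaching h_path n_gt0 q0.
  have [_ + _] := down `|(q0 - h (x - 1))%R|%N; apply; exists (x - 1) => //.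
  by lia.
have [x [hx nFx]] := range_last h_path n_gt0 Yj.
have xj : x <= j by have := dyck (x - 1); rewrite hx; lia.
have hj : h (j + 1) = h x.
  apply: (@countz_inj (range h)); [by exists (j + 1)|by exists x|].
  have := countz_range_step h_path x; rewrite memNset // hx.
  move: gj1; rewrite /gap (countz_notin nYj1) addrK; lia.
(* The run of vertical steps at height [h x] ends at first coordinate [y], which is where the next
   valley is. *)
have [y [hy1 hy2]] := path_reaching h_path n_gt0 (h x + 1).
have jy : j + 1 < y.
  rewrite ltNge; apply/negP => yj; have := h_path.1 y (j + 1) yj; lia.
have nFy : ~ falls h y by apply/(not_fallsE h_path); lia.
exists (x, j); split; first exact/(valleyE h_path).
exists (y, h (y - 1)); split=> //; split=> /=.
- exact/(valleyE h_path).
- by lia.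
- move=> [u1 u2] /(valleyE h_path)[_ /(not_fallsE h_path) hu] /= xu.
  rewrite leNgt; apply/negP => uy.
  have : h u1 <= h (y - 1) by apply: h_path.1; lia.
  have : h x <= h (u1 - 1) by apply: h_path.1; lia.
  by lia.
Qed.

End Families.

(** * The two families of paths and their exchange under duality *)

Lemma DP_gapP n D : (1 <= n)%N ->
  DP n D <-> [/\ periodic_path n D, exists x, falls D x, forall k, 0 <= gap D k
    & exists p, [/\ ~ falls D p, range D p & gap D p = 0]].
Proof.
move=> n_gt0; split.
  move=> [[Dp dyck] /(falls_nonemptyP Dp n_gt0) F0 [[k ak] _]].
  have g_ge0 := (dyck_gapP D).1 dyck.
  (* An area entry 2 at [k] means [D k = k + 1], a return at [k + 1]. *)
  split=> //; exists (k + 1); apply/(return_at_gap Dp) => //.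
  by rewrite /return_at /vstep addrK; move: ak; rewrite /area; lia.
move=> [Dp F0 g_ge0 [p /(return_at_gap Dp p g_ge0) ret]].
have dyck := (dyck_gapP D).2 g_ge0.
split=> //; first exact/(falls_nonemptyP Dp n_gt0).
split; last by move=> k; rewrite /area; have := dyck k; lia.
by exists (p - 1); rewrite /area (ret : D (p - 1) = p); lia.
Qed.

Lemma DH_gapP n D : (1 <= n)%N ->
  DH n D <-> [/\ periodic_path n D, forall k, 0 <= gap D k
    & exists q, [/\ falls D q, ~ range D q & gap D q = 0]].
Proof.
move=> n_gt0; split.
  move=> [[Dp dyck] [[x j] rect]].
  have g_ge0 := (dyck_gapP D).1 dyck.
  by split=> //; exists (j + 1); exact: (rectangle_gap Dp g_ge0 rect).
move=> [Dp g_ge0 ex]; split; first by split=> //; exact/(dyck_gapP D).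
exact: (rectangle_exists Dp n_gt0).
Qed.

(** Exchanging range and falls turns a zero of return type into one of rectangle type at the same
    point. *)
Lemma dual_DP n D E : (1 <= n)%N -> periodic_path n E -> dual_path D E ->
  DP n D -> DH n E.
Proof.
move=> n_gt0 Ep DE /(DP_gapP D n_gt0)[Dp _ g_ge0 [p [nFp Yp gp]]].
apply/(DH_gapP E n_gt0); rewrite DE.2; split=> //; exists p.
by rewrite (dual_falls Dp Ep DE) DE.1.
Qed.

Lemma dual_DH n D E : (1 <= n)%N -> periodic_path n E -> dual_path D E ->
  DH n D -> DP n E.
Proof.
move=> n_gt0 Ep DE /(DH_gapP D n_gt0)[Dp g_ge0 [q [Fq nYq gq]]].
apply/(DP_gapP E n_gt0); rewrite DE.2.
rewrite (dual_falls Dp Ep DE) DE.1.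
(* The height [D 0] of [D] is a fall of [E]. *)
by split=> //; [exists (D 0); exists 0 | exists q].
Qed.

(** * Both maps compute the dual path *)

Lemma path_with_valleys_coords n h r f : (1 <= n)%N ->
  path_with_valleys n r f h -> falls h = ~` range r /\ range h = range f.
Proof.
move=> n_gt0 [h_path vE].
have vr x : ~ falls h x <-> range r x.
  split=> [nFx|[t _ <-]].
    have : valley h (x, h (x - 1)) by apply/(valleyE h_path).
    by rewrite vE => -[t _ [<- _]]; exists t.
  have : valley h (r t, f t) by rewrite vE; exists t.
  by move=> /(valleyE h_path)[].
split; apply/seteqP; split=> y.
- by move=> Fy /vr.
- by move=> ny; apply: contrapT => /vr.
- move=> /(range_last h_path n_gt0)[x [hx nFx]].
  have : valley h (x, y) by apply/(valleyE h_path).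
  by rewrite vE => -[t _ [_ <-]]; exists t.
- move=> [t _ <-]; have : valley h (r t, f t) by rewrite vE; exists t.
  by move=> /(valleyE h_path)[<- _]; exists (r t - 1).
Qed.

Section Characterisation.
Variables (n : nat) (D E : lattice_path).
Hypotheses (n_gt0 : (1 <= n)%N) (D_path : periodic_path n D).

Lemma LK_coords r f :
  increasing_enum (rises D) r -> increasing_enum (falls D) f ->
  path_with_valleys n r f E -> falls E = range D /\ range E = falls D.
Proof.
move=> [_ rR] [_ fR] /(path_with_valleys_coords n_gt0)[-> ->].
by rewrite rR fR (risesE D_path n_gt0) setCK.
Qed.

(** The base point is [p]. No rise of [D] lies between [p] and [r 1], so [E] is constant there and
    [E p = f 1], the first fall beyond [p]; both gaps at [p] are 0. *)
Lemma is_LKP_dual : (forall k, 0 <= gap D k) -> is_LKP n D E ->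
  periodic_path n E /\ dual_path D E.
Proof.
move=> g_ge0 [p [r [f [ret [er [Rr1 pr1 r1min]] [ef [Ff1 pf1 f1min]] pv]]]].
have [eF eR] := LK_coords er ef pv.
have E_path := pv.1.
split=> //; apply: (dual_of_base D_path E_path (p := p)) => //.
have [_ _ ->] := (return_at_gap D_path p g_ge0).1 ret.
have /(valleyE E_path)[hr1 _] : valley E (r 1, f 1).
  by rewrite pv.2; exists 1.
have Ep : E p = f 1.
  rewrite -hr1; symmetry; apply: constant_on_falls; first lia.
  move=> m pm mr; rewrite eF; apply: contrapT => nY.
  have Rm : rises D m by rewrite (risesE D_path n_gt0).
  by have := r1min m Rm pm; lia.
by rewrite /gap eR Ep (@countz_next (falls D) p (f 1)) //; lia.
Qed.

(** The base point is [j + 1]: the valley [(r 1, f 1)] gives [E j = j + 1], a return of [E], so both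
    gaps at [j + 1] are 0. *)
Lemma is_LKH_dual : (forall k, 0 <= gap D k) -> is_LKH n D E ->
  periodic_path n E /\ dual_path D E.
Proof.
move=> g_ge0 [j [r [f [[x rect] [er r1] [ef f1] pv]]]].
have [eF eR] := LK_coords er ef pv.
have E_path := pv.1.
split=> //; apply: (dual_of_base D_path E_path (p := j + 1)) => //.
have [Fj nYj ->] := rectangle_gap D_path g_ge0 rect.
have /(valleyE E_path)[hr1 _] : valley E (r 1, f 1).
  by rewrite pv.2; exists 1.
rewrite r1 f1 addrK in hr1.
have := gap_pred E_path (j + 1).
rewrite eF eR mem_set // memNset // (addrK (1 : int) j) [gap E j]/gap hr1 eR.
by rewrite (countz_in Fj) (addrK (1 : int) j); lia.
Qed.

(* A point [p] of gap 0 is a common origin for the two enumerations. *)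
Lemma dual_enumerations (p : int) : periodic_path n E -> dual_path D E ->
  (exists x, falls D x) -> gap D p = 0 ->
  exists r f,
  [/\ increasing_enum (rises D) r /\
        (forall t, countz (rises D) (r t) = t + countz (rises D) p),
      increasing_enum (falls D) f /\
        (forall t, countz (falls D) (f t) = t + countz (falls D) p)
    & path_with_valleys n r f E].
Proof.
move=> E_path DE F0 gp.
have eF := dual_falls D_path E_path DE.
have eR := DE.1.
have RE := risesE D_path n_gt0.
(* The last vertical step of [E] at height [E 0] is followed by a non-fall of [E], that is, a rise
   of [D]. *)
have R0 : exists x, rises D x.
  have [x [_ nFx]] := range_last E_path n_gt0 (ex_intro2 _ _ 0 I erefl).
  by exists x; rewrite RE -eF.
have [r [er cr]] :=
  increasing_enum_exists (rises_periodic D_path n_gt0) n_gt0 R0 p.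
have [f [ef cf]] := increasing_enum_exists (falls_periodic D_path) n_gt0 F0 p.
exists r, f; split=> //; split=> //.
have Rr t : rises D (r t) by rewrite -er.2; exists t.
have Ff t : falls D (f t) by rewrite -ef.2; exists t.
(* [E] passes to its next height exactly at the rises of [D], so both counts grow together; the
   value at [p] comes from the zero gap. *)
have balance (k : int) : countz (falls D) (E k) - countz (rises D) k =
    countz (falls D) p - countz (rises D) p + 1.
  move: k; apply: (int_bidirectional_ind (k0 := p)) => [|k].
    by move: (congr1 (@^~ p) DE.2); rewrite /= gp /gap eR; lia.
  have := countz_range_step E_path k.
  rewrite eR eF; have [Yk|nYk] := pselect (range D k).
    rewrite mem_set // (@countz_notin (rises D) k); last by rewrite RE.
    by split; lia.
  rewrite memNset // (@countz_in (rises D) k) ?RE //.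
  by split; lia.
have Er t : E (r t - 1) = f t.
  apply: (@countz_inj (falls D)) => //; first by rewrite -eR; exists (r t - 1).
  have := balance (r t - 1); have := countz_in (Rr t).
  by rewrite cr cf; lia.
have nFr t : ~ falls E (r t) by rewrite eF; have := Rr t; rewrite RE.
apply/seteqP; split=> [[x y]|_ [t _ <-]]; last first.
  by apply/(valleyE E_path); split.
move=> /(valleyE E_path)[hx].
rewrite eF => nYx; have : rises D x by rewrite RE.
by rewrite -er.2 => -[t _ rt]; exists t => //; rewrite -hx -rt Er.
Qed.

End Characterisation.

Lemma LKP_dual n D : (1 <= n)%N -> DP n D ->
  periodic_path n (LKP n D) /\ dual_path D (LKP n D).
Proof.
(* Every candidate for [xget] is dual to [D], so only the existence of one remains to be shown. *)
move=> n_gt0 /(DP_gapP D n_gt0)[D_path F0 g_ge0 [p pP]].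
apply: is_LKP_dual => //; apply: xgetPex.
have [E [E_path DE]] := dual_exists n_gt0 D_path F0.
have [_ _ gp] := pP.
have [r [f [[er cr] [ef cf] pv]]] :=
  dual_enumerations n_gt0 D_path E_path DE F0 gp.
have smallest A a : increasing_enum A a ->
    (forall t, countz A (a t) = t + countz A p) -> smallest_above A p (a 1).
  move=> [_ eA] ca; split.
  - by rewrite -eA; exists 1.
  - by rewrite ltNge; apply/negP => /(@countz_le A); rewrite ca; lia.
  - move=> x Ax px; rewrite leNgt; apply/negP => xa.
    have : A (a 1) by rewrite -eA; exists 1.
    move=> /(@countz_lt A x)/(_ xa); rewrite ca.
    by have := countz_lt Ax px; lia.
exists E, p, r, f; split=> //; first exact/(return_at_gap D_path).
- by split=> //; exact: smallest.
- by split=> //; exact: smallest.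
Qed.

Lemma LKH_dual n D : (1 <= n)%N -> DH n D ->
  periodic_path n (LKH n D) /\ dual_path D (LKH n D).
Proof.
move=> n_gt0 DD; have [_ [[x j] rect]] := DD.
move/(DH_gapP D n_gt0): DD => [D_path g_ge0 _].
apply: is_LKH_dual => //; apply: xgetPex.
have [Fj nYj gj1] := rectangle_gap D_path g_ge0 rect.
have F0 : exists y, falls D y by exists (j + 1).
(* Counting from [j], also a zero of the gap, gives index 1 to [j + 1] in both enumerations. *)
have gj : gap D j = 0.
  have := gap_pred D_path (j + 1).
  by rewrite memNset // mem_set // gj1 (addrK (1 : int) j); lia.
have [E [E_path DE]] := dual_exists n_gt0 D_path F0.
have [r [f [[er cr] [ef cf] pv]]] :=
  dual_enumerations n_gt0 D_path E_path DE F0 gj.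
have first_enum A a : increasing_enum A a -> A (j + 1) ->
    (forall t, countz A (a t) = t + countz A j) -> a 1 = j + 1.
  move=> [_ eA] Aj ca; apply: (@countz_inj A) => //.
    by rewrite -eA; exists 1.
  by rewrite ca (countz_in Aj) addrK addrC.
exists E, j, r, f; split=> //; first by exists x.
- split=> //; apply: first_enum cr => //.
  by rewrite (risesE D_path n_gt0).
- by split=> //; exact: first_enum cf.
Qed.

Theorem theorem3p25 (n : nat) (hn : (1 <= n)%N) :
  [/\ set_bij (DP n) (DH n) (LKP n),
      set_fun (DH n) (DP n) (LKH n),
      forall D, DP n D -> LKH n (LKP n D) = D,
      forall D, DH n D -> LKP n (LKH n D) = D
    & forall D, (DP n `&` DH n) D ->
        (DP n `&` DH n) (LKP n D) /\ LKP n (LKP n D) = D].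
Proof.
have funP : set_fun (DP n) (DH n) (LKP n).
  by move=> D DD; have [Ep DE] := LKP_dual hn DD; exact: (dual_DP hn Ep DE).
have funH : set_fun (DH n) (DP n) (LKH n).
  by move=> D DD; have [Ep DE] := LKH_dual hn DD; exact: (dual_DH hn Ep DE).
have pathP D : DP n D -> periodic_path n D by case=> -[].
have pathH D : DH n D -> periodic_path n D by case=> -[].
(* Both sides are dual to [LKP n D]. *)
have LKHK D : DP n D -> LKH n (LKP n D) = D.
  move=> DD; have [Ep DE] := LKP_dual hn DD.
  have [_ ED] := LKH_dual hn (funP _ DD).
  exact: dual_unique ED (dual_sym (pathP _ DD) Ep DE).
have LKPK D : DH n D -> LKP n (LKH n D) = D.
  move=> DD; have [Ep DE] := LKH_dual hn DD.
  have [_ ED] := LKP_dual hn (funH _ DD).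
  exact: dual_unique ED (dual_sym (pathH _ DD) Ep DE).
split=> //.
  split=> //.
    move=> D1 D2 /set_mem DD1 /set_mem DD2 e.
    by rewrite -(LKHK _ DD1) e LKHK.
  by move=> E EE; exists (LKH n E); [exact: funH | exact: LKPK].
move=> D [DP_D DH_D].
(* On the intersection both maps yield the one dual path, so the involution follows from mutual
   inverseness. *)
have eqPH : LKP n D = LKH n D.
  exact: dual_unique (LKP_dual hn DP_D).2 (LKH_dual hn DH_D).2.
split; last by rewrite eqPH LKPK.
by split; [rewrite eqPH; exact: funH | exact: funP].
Qed.
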